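(* If $K \subseteq \mathbb{R}^{2\times 2}$ is a compact set such that $\det(X-Y) \geq 0$ for every $X,Y \in K$, then $K^{pc} = L^{(2)}(K)$.
   Context: $\mathbb{R}^{2\times 2}$ is the space of real $2 \times 2$ matrices. For a set $K \subseteq \mathbb{R}^{2\times 2}$, put $L^{(0)}(K) = K$ and define inductively \[ L^{(k+1)}(K) = \bigcup_{\substack{X,Y \in L^{(k)}(K) \\ \operatorname{rank}(X-Y) \leq 1}} [X,Y], \] where $[X,Y]$ is the closed line segment joining $X$ and $Y$. A function $f : \mathbb{R}^{2\times 2} \to \mathbb{R}$ is polyconvex if there is a convex function $g : \mathbb{R}^{2\times 2} \times \mathbb{R} \to \mathbb{R}$ with $f(X) = g(X, \det X)$ for all $X \in \mathbb{R}^{2\times 2}$. The polyconvex hull of a compact set $K \subseteq \mathbb{R}^{2\times 2}$ is \[ K^{pc} = \{ X \in \mathbb{R}^{2\times 2} : f(X) \leq 0 \text{ for every polyconvex } f : \mathbb{R}^{2\times 2}\to\mathbb{R} \text{ with } f|_K \leq 0 \}. \] The following known characterisation holds for compact $K$: $K^{pc} = \{ \overline{\mu} : \mu \in \mathscr{M}_{pc}(K)\}$, where $\mathscr{M}_{pc}(K)$ is the class of probability measures $\mu$ supported in $K$ satisfying $f(\overline{\mu}) \leq \int_{\mathbb{R}^{2\times 2}} f(X)\, d\mu(X)$ for all polyconvex $f$, with $\overline{\mu} = \int_{\mathbb{R}^{2\times 2}} X \, d\mu(X)$. *)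

(* Defs.v *)
From HB Require Import structures.
From mathcomp Require Import all_boot all_order all_algebra.
From mathcomp Require Import all_classical all_reals all_analysis.

Set Implicit Arguments.
Unset Strict Implicit.
Unset Printing Implicit Defensive.

Import Order.TTheory GRing.Theory Num.Theory.
Import numFieldNormedType.Exports.

Local Open Scope classical_set_scope.
Local Open Scope convex_scope.
Local Open Scope ring_scope.

Definition mx_segment (R : realType) (X Y : 'M[R]_2) : set 'M[R]_2 :=
  [set Z | exists t : {i01 R},
     Z = (X : convex_lmodType 'M[R]_2) <| t |> (Y : convex_lmodType 'M[R]_2)].

Fixpoint lamination (R : realType) (k : nat) (K : set 'M[R]_2) :
    set 'M[R]_2 :=
  if k is k'.+1 then
    \bigcup_(p in [set p : 'M[R]_2 * 'M[R]_2 |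
                   [/\ lamination k' K p.1, lamination k' K p.2
                     & (\rank (p.1 - p.2)%R <= 1)%N]])
      mx_segment p.1 p.2
  else K.

(* [R^o] is [R] viewed as a module over itself, so that the domain of [g] is
   the real vector space 'M[R]_2 * R; [g] takes finite values everywhere. *)
Definition polyconvex (R : realType) (f : 'M[R]_2 -> R) : Prop :=
  exists2 g : 'M[R]_2 * R^o -> R,
    @convex_function R ('M[R]_2 * R^o)%type setT g &
    forall X : 'M[R]_2, f X = g (X, \det X).

Definition polyconvex_hull (R : realType) (K : set 'M[R]_2) : set 'M[R]_2 :=
  [set X | forall f : 'M[R]_2 -> R,
     polyconvex f -> (forall Y, K Y -> f Y <= 0) -> f X <= 0].

(* Main.v *)
Require Import Defs.
From HB Require Import structures.
From mathcomp Require Import all_boot all_order all_algebra.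
From mathcomp Require Import all_classical all_reals all_analysis.
From mathcomp Require Import ring.

(* The convex hull [H] of the graph of [\det] over [K] is closed, by
   Caratheodory's theorem.  The distance to [H] is convex, so composing it with
   [X |-> (X, \det X)] gives a polyconvex function vanishing on [K]; hence every
   [X] in the polyconvex hull satisfies [X = \sum_i w i *: y i] and
   [\det X = \sum_i w i * \det (y i)] for some [y i] in [K].  Then
   [\sum_(i, j) w i * w j * \det (y i - y j) = 0], so the points of positive
   weight are pairwise rank-one connected.  Their differences span a totally
   isotropic subspace of [\det], of dimension at most 2, so three of the points
   suffice to represent [X], and two laminations reach it.  Conversely [\det] is
   affine along rank-one segments, so laminates stay in the polyconvex hull. *)

Set Implicit Arguments.
Unset Strict Implicit.
Unset Printing Implicit Defensive.

Import Order.TTheory GRing.Theory Num.Theory.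
Import VectorInternalTheory.
Import numFieldNormedType.Exports.

Local Open Scope classical_set_scope.
Local Open Scope ring_scope.

(** * Carathéodory's reduction: discarding a point without moving the barycentre *)

Definition weights (R : realType) n (w : 'I_n -> R) :=
  (forall i, 0 <= w i) /\ \sum_i w i = 1.

(** The column of ones in [B] encodes that the coefficients sum to 0. It raises the rank by at most
    one, so [B] still has a nonzero left kernel. *)
Lemma affine_dependence (F : fieldType) n m (A : 'M[F]_(n, m)) :
  ((\rank A).+1 < n)%N ->
  exists u : 'rV[F]_n, [/\ u != 0, \sum_i u 0 i = 0 & u *m A = 0].
Proof.
move=> An.
pose B := row_mx A (const_mx 1 : 'cV_n).
have rB : (\rank B <= (\rank A).+1)%N.
  rewrite -mxrank_tr tr_row_mx -addsmxE.
  apply: leq_trans (mxrank_adds_leqif _ _) _.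
  rewrite mxrank_tr -(addn1 (\rank A)).
  by apply: leq_add => //; apply: rank_leq_row.
have : kermx B != 0.
  by rewrite kermx_eq0 /row_free neq_ltn (leq_ltn_trans rB An).
case/rowV0Pn => u /sub_kermxP; rewrite mul_mx_row => uB u0.
exists u; split => //.
- have /(congr1 rsubmx) := uB; rewrite row_mxKr linear0.
  move=> /matrixP/(_ 0 0); rewrite !mxE => uB0; rewrite -[RHS]uB0.
  by apply: eq_bigr => i _; rewrite mxE mulr1.
- by have /(congr1 lsubmx) := uB; rewrite row_mxKl linear0.
Qed.

(* Moving the weights along [u] until the first one vanishes. *)
Lemma drop_weight (R : realType) n (w u : 'I_n.+1 -> R) :
    weights w -> \sum_i u i = 0 -> (exists i, u i != 0) ->
  exists (j : 'I_n.+1) t,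
    weights (fun i => w (lift j i) - t * u (lift j i)) /\ w j = t * u j.
Proof.
move=> [w0 w1] us [k uk].
have [i0 ui0] : exists i, 0 < u i.
  apply/existsP; apply: contraT => /existsPn un.
  have un' i : 0 <= - u i by rewrite oppr_ge0 leNgt un.
  have /eqP : \sum_i - u i = 0 by rewrite sumrN us oppr0.
  rewrite psumr_eq0// => /allP /(_ k (mem_index_enum k)) /=.
  by rewrite oppr_eq0 (negPf uk).
have [j uj jmin] := @Order.TotalTheory.arg_minP _ _ _ i0
  (fun i => 0 < u i) (fun i => w i / u i) ui0.
have wj : w j = w j / u j * u j by rewrite divfK// gt_eqF.
exists j, (w j / u j); split=> //; split.
- move=> i; rewrite subr_ge0; set k' := lift j i.
  have [uk'|uk'] := ltP 0 (u k').
    by rewrite -ler_pdivlMr// jmin.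
  apply: le_trans (w0 k'); apply: mulr_ge0_le0 => //.
  by rewrite divr_ge0// ltW.
- have wE := w1; rewrite (bigD1_ord j)//= in wE.
  have uE := us; rewrite (bigD1_ord j)//= in uE.
  rewrite sumrB -mulr_sumr -wE [w j in RHS]wj.
  have -> : u j = - \sum_(i < n) u (lift j i).
    by apply/eqP; rewrite -addr_eq0 uE.
  by rewrite mulrN addrC.
Qed.

(** [A] stands in for the points: its affine relations carry over to [y]. Leaving it abstract lets
    one step serve both the bound by dimension and the sharper isotropic bound. *)
Lemma caratheodory_step (R : realType) (V : lmodType R) n m
    (w : 'I_n.+1 -> R) (y : 'I_n.+1 -> V) (A : 'M[R]_(n.+1, m)) :
    weights w -> (\rank A < n)%N ->
    (forall u : 'rV_n.+1, u *m A = 0 -> \sum_i u 0 i = 0 ->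
      \sum_i u 0 i *: y i = 0) ->
  exists (j : 'I_n.+1) (w' : 'I_n -> R), weights w' /\
    \sum_i w' i *: y (lift j i) = \sum_i w i *: y i.
Proof.
move=> ww An Ay; have [u [u0 us uA]] := @affine_dependence _ _ _ A An.
have [|j [t [wt wj]]] := @drop_weight _ _ w (fun i => u 0 i) ww us.
  by apply/existsP; rewrite -negb_forall; apply: contra u0 => /forallP u0;
    apply/eqP/rowP => i; rewrite mxE; apply/eqP.
exists j; eexists; split; first exact: wt.
have uy := Ay u uA us; rewrite (bigD1_ord j)//= in uy.
rewrite (bigD1_ord j)//=; under eq_bigr do rewrite scalerBl -scalerA.
rewrite sumrB -scaler_sumr wj -scalerA addrC; congr (_ + _).
by rewrite -scalerN; congr (_ *: _); apply/esym/eqP; rewrite -addr_eq0 uy.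
Qed.

(** * The determinant as a quadratic form on 2 x 2 matrices *)

Lemma det2 (R : comPzRingType) (X : 'M[R]_2) :
  \det X = X 0 0 * X 1 1 - X 0 1 * X 1 0.
Proof.
rewrite (expand_det_row _ 0) !big_ord_recl big_ord0 /cofactor !det_mx11 !mxE /=.
have -> : lift 0 0 = 1 :> 'I_2 by apply/val_inj.
have -> : lift 1 0 = 0 :> 'I_2 by apply/val_inj.
rewrite /= expr0 expr1; ring.
Qed.

Lemma rank_le1_det (F : fieldType) (X : 'M[F]_2) :
  (\rank X <= 1)%N = (\det X == 0).
Proof.
have := row_free_unit X; rewrite unitmxE unitfE /row_free => XE.
rewrite -[RHS]negbK -XE neq_ltn; have := rank_leq_row X.
by case: (\rank X) => [|[|[|]]].
Qed.

Definition mx2_coords (R : nzRingType) n (y : 'I_n -> 'M[R]_2) : 'M[R]_(n, 4) :=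
  \matrix_(i, k) [:: y i 0 0; y i 0 1; y i 1 0; y i 1 1]`_k.

Lemma mx2_coordsE (R : nzRingType) n (y : 'I_n -> 'M[R]_2) k (i j : 'I_2) :
  mx2_coords y k (inord (i * 2 + j)) = y k i j.
Proof.
rewrite mxE; case: i j => [[|[|//]] ?] [[|[|//]] ?]; rewrite inordK//=;
  by congr (y k _ _); apply/val_inj.
Qed.

(* Totally isotropic subspaces of the quadratic form [\det], of signature
   (2, 2), have dimension at most 2. *)
Lemma isotropic_rank (F : fieldType) n (y : 'I_n -> 'M[F]_2) :
  (forall i, \det (y i) = 0) -> (forall i j, \det (y i - y j) = 0) ->
  (\rank (mx2_coords y) <= 2)%N.
Proof.
move=> y0 yy; set A := mx2_coords y.
(* [S] is the Gram matrix of the polar form [\det x + \det y - \det (x - y)] in the coordinates of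
   [mx2_coords]. *)
pose S : 'M[F]_4 := \matrix_(i, j)
  if (i + j == 3)%N
  then (-1) ^+ (i == 1%N :> nat) * (-1) ^+ (i == 2%N :> nat) else 0.
have SS : S *m S = 1%:M.
  apply/matrixP => -[[|[|[|[|//]]]] ?] [[|[|[|[|//]]]] ?];
  rewrite !mxE !big_ord_recl big_ord0 !mxE /= /bump /=; ring.
have freeS : row_free S.
  by rewrite row_free_unit; case/mulmx1_unit: SS.
have ASA : A *m S *m A^T = 0.
  apply/matrixP => i j.
  transitivity (\det (y i) + \det (y j) - \det (y i - y j)); last first.
    by rewrite !y0 yy mxE !addr0 subr0.
  rewrite !det2 !mxE.
  rewrite !big_ord_recl big_ord0 !mxE !big_ord_recl !big_ord0 !mxE /= /bump /=.
  ring.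
(* As [S] is invertible, this reads [\rank A + \rank A <= 4]. *)
have := mulmx0_rank_max ASA.
by rewrite mxrank_tr mxrankMfree// addnn -(@leq_double _ 2).
Qed.

(** * Convex combinations of a fixed number of points *)

Definition convex_comb (R : realType) (V : lmodType R) n (A : set V) : set V :=
  [set x | exists (w : 'I_n -> R) (y : 'I_n -> V),
    [/\ weights w, forall i, A (y i) & x = \sum_i w i *: y i]].

Lemma convex_comb_step (R : realType) (V : lmodType R) n m (A : set V)
    (f : ('I_n.+1 -> V) -> 'M[R]_(n.+1, m)) :
    (forall y, (forall i, A (y i)) -> (\rank (f y) < n)%N) ->
    (forall y (u : 'rV_n.+1), u *m f y = 0 -> \sum_i u 0 i = 0 ->
      \sum_i u 0 i *: y i = 0) ->
  convex_comb n.+1 A `<=` convex_comb n A.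
Proof.
move=> fn fy x [w [y [ww yA ->]]].
have [j [w' [ww' yw']]] := caratheodory_step ww (fn y yA) (fy y).
by exists w', (y \o lift j); split => // i; exact: yA.
Qed.

Lemma convex_comb_finite_dim (R : realType) (V : vectType R) n (A : set V) :
  (dim V < n)%N -> convex_comb n.+1 A `<=` convex_comb n A.
Proof.
move=> Vn.
apply: (@convex_comb_step _ _ _ _ _
  (fun y => \matrix_i v2r (y i))) => [y _|y u].
  by rewrite (leq_ltn_trans _ Vn)// rank_leq_col.
rewrite mulmx_sum_row => uy _; apply: v2r_inj.
rewrite linear0 linear_sum -[RHS]uy; apply: eq_bigr => i _.
by rewrite linearZ rowK.
Qed.

(** With [y 0] as origin, the vectors [y i - y 0] and their mutual differences are all isotropic,
    hence of rank at most 2. *)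
Lemma convex_comb_isotropic (R : realType) n (A : set 'M[R]_2) :
  (2 < n)%N -> (forall X Y, A X -> A Y -> \det (X - Y) = 0) ->
  convex_comb n.+1 A `<=` convex_comb n A.
Proof.
move=> n2 A0.
apply: (@convex_comb_step _ _ _ _ _
  (fun y => mx2_coords (fun i => y i - y 0))) => [y yA|y u].
  apply: leq_ltn_trans n2; apply: isotropic_rank => [i|i j]; first exact: A0.
  by rewrite opprB addrA subrK; exact: A0.
move=> uy us; have uy0 : \sum_i u 0 i *: (y i - y 0) = 0.
  apply/matrixP => i j; rewrite summxE !mxE.
  have -> : \sum_k (u 0 k *: (y k - y 0)) i j =
      (u *m mx2_coords (fun i => y i - y 0)) 0 (inord (i * 2 + j)).
    by rewrite mxE; apply: eq_bigr => k _; rewrite mx2_coordsE !mxE.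
  by rewrite uy mxE.
(* The origin [y 0] drops out because the coefficients sum to 0. *)
move: uy0; under eq_bigr do rewrite scalerBr.
by rewrite sumrB -scaler_suml us scale0r subr0.
Qed.

Lemma convex_comb_reduce (R : realType) (V : lmodType R) k m (A : set V) :
  (forall n, (k <= n)%N -> convex_comb n.+1 A `<=` convex_comb n A) ->
  convex_comb (k + m) A `<=` convex_comb k A.
Proof.
move=> kA; elim: m => [|m IH]; first by rewrite addn0.
by rewrite addnS => x /kA xA; apply/IH/xA/leq_addr.
Qed.

(** The two families are concatenated, so the numbers of points add up; [convex_comb_reduce] brings
    the count back down. *)
Lemma convex_comb_conv (R : realType) (V : lmodType R) n m (A : set V)
    (t : R) x y :
  0 <= t -> t <= 1 -> convex_comb n A x -> convex_comb m A y ->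
  convex_comb (n + m) A (t *: x + (1 - t) *: y).
Proof.
move=> t0 t1 [w [p [[w0 w1] pA ->]]] [v [q [[v0 v1] qA ->]]].
exists (fun i => match fintype.split i with
                 | inl j => t * w j | inr k => (1 - t) * v k end).
exists (fun i => match fintype.split i with inl j => p j | inr k => q k end).
have splitl j : fintype.split (lshift m j : 'I_(n + m)) = inl j.
  exact: (unsplitK (inl j)).
have splitr j : fintype.split (rshift n j : 'I_(n + m)) = inr j.
  exact: (unsplitK (inr j)).
split.
- split.
    by move=> i; case: (fintype.split i) => j; rewrite mulr_ge0 ?subr_ge0.
  rewrite big_split_ord/=.
  under eq_bigr do rewrite splitl; under [X in _ + X]eq_bigr do rewrite splitr.
  by rewrite -!mulr_sumr w1 v1 !mulr1 subrKC.
- by move=> i; case: (fintype.split i).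
- rewrite big_split_ord/=.
  under [in RHS]eq_bigr do rewrite splitl.
  under [X in _ = _ + X]eq_bigr do rewrite splitr.
  rewrite !scaler_sumr.
  by congr (_ + _); apply: eq_bigr => i _; rewrite scalerA.
Qed.

Lemma subset_convex_comb (R : realType) (V : lmodType R) n (A : set V) :
  A `<=` convex_comb n.+1 A.
Proof.
move=> x Ax; exists (fun i => (i == 0)%:R), (fun=> x); split => //.
- split=> [i|]; first exact: ler0n.
  by rewrite (bigD1 0)//= big1 ?addr0// => i /negPf ->.
- rewrite (bigD1 0)//= scale1r big1 ?addr0// => i /negPf ->.
  by rewrite scale0r.
Qed.

(** * Closedness of the combinations of points of a compact set *)

Lemma continuous_sum (R : numFieldType) (V : normedModType R)
    (T : topologicalType) (I : Type) (r : seq I) (f : I -> T -> V) :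
  (forall i, continuous (f i)) -> continuous (fun x => \sum_(i <- r) f i x).
Proof.
move=> fc; elim: r => [|i r IH] x.
  under eq_fun do rewrite big_nil; exact: cvg_cst.
under eq_fun do rewrite big_cons.
by apply: cvgD; [exact: fc|exact: IH].
Qed.

Lemma continuous_pair (T U V : topologicalType) (f : T -> U) (g : T -> V) :
  continuous f -> continuous g -> continuous (fun x => (f x, g x)).
Proof. by move=> fc gc x; exact: cvg_pair (fc x) (gc x). Qed.

Lemma convex_comb_closed (R : realType) (V : normedModType R) n (A : set V) :
  compact A -> closed (convex_comb n A).
Proof.
move=> Ac.
pose B := [set p : R * V | 0 <= p.1 <= 1 /\ A p.2].
have Bc : compact B.
  have -> : B = `[0, 1] `*` A.
    by apply/seteqP; split=> -[t x] /=; rewrite in_itv.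
  by apply: compact_setX => //; exact: segment_compact.
pose T : topologicalType := prod_topology (fun _ : 'I_n => (R * V)%type).
(* The weights range over a full cube; [F] also records their sum, and the condition that it be 1 is
   imposed afterwards by slicing the compact image. *)
pose F (f : T) : R^o * V :=
  (\sum_i (f i).1, \sum_i (f i).1 *: (f i).2).
have projc i : continuous (fun f : T => f i) by exact: proj_continuous.
have Fc : continuous F.
  have c1 i : continuous (fun f : T => (f i).1).
    move=> f; apply: cvg_comp (projc i f) _.
    by case: (f i) => a b; exact: cvg_fst.
  have c2 i : continuous (fun f : T => (f i).2).
    move=> f; apply: cvg_comp (projc i f) _.
    by case: (f i) => a b; exact: cvg_snd.
  have c3 i : continuous (fun f : T => (f i).1 *: (f i).2).
    by move=> f; exact: (@cvgZ _ _ _ (nbhs f) _ _ _ _ _ (c1 i f) (c2 i f)).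
  have s1 := @continuous_sum _ R^o T _ (index_enum 'I_n) _ c1.
  have s2 := @continuous_sum _ V T _ (index_enum 'I_n) _ c3.
  exact: continuous_pair s1 s2.
have FBcl : closed (F @` [set f : T | forall i, B (f i)]).
  apply: compact_closed; first exact: norm_hausdorff.
  apply: (@continuous_compact T (R^o * V)%type F).
    exact: continuous_subspaceT.
  exact: (@tychonoff _ (fun=> (R * V)%type) (fun=> B)).
have -> : convex_comb n A =
    (fun z => (1, z)) @^-1` (F @` [set f : T | forall i, B (f i)]).
  apply/seteqP; split => z /=.
    move=> [w [y [[w0 w1] yA ->]]]; exists (fun i => (w i, y i)).
      move=> i; split=> //=; rewrite w0 /= -w1 (bigD1 i)//= lerDl.
      by rewrite sumr_ge0.
    by rewrite /F /= w1.
  move=> [f fB [f1 fz]]; exists (fun i => (f i).1), (fun i => (f i).2).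
  split => [||//]; last by move=> i; case: (fB i).
  by split=> // i; case: (fB i) => /andP[].
apply: preimage_closed => // z _.
by apply: continuous_pair => ?; [exact: cvg_cst|exact: cvg_id].
Qed.

(** * The distance to a convex set *)

Definition distance (R : realType) (V : normedModType R) (H : set V)
    (z : V) : R :=
  inf [set `|z - c| | c in H].

Lemma distance_has_inf (R : realType) (V : normedModType R) (H : set V) z :
  H !=set0 -> has_inf [set `|z - c| | c in H].
Proof.
move=> [c Hc]; split; first by exists `|z - c|, c.
by exists 0 => _ [c' _ <-].
Qed.

Lemma distance_convex (R : realType) (V : normedModType R) (H : set V) :
  H !=set0 ->
  (forall t x y, 0 <= t -> t <= 1 -> H x -> H y -> H (t *: x + (1 - t) *: y)) ->
  convex_function setT (distance H : convex_lmodType V -> R).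
Proof.
move=> H0 Hc t x y _ _.
have -> : conv t (distance H x : R^o) (distance H y) =
    t%:num * distance H x + (1 - t%:num) * distance H y by [].
have -> : conv t x y = t%:num *: (x : V) + (1 - t%:num) *: (y : V) by [].
have t0 : 0 <= t%:num by [].
have t1 : t%:num <= 1 by [].
move: (t%:num) t0 t1 => {}t t0 t1.
(* The infima need not be attained, so points optimal up to [e] are combined. *)
apply/ler_addgt0Pr => e e0.
have [_ [c1 Hc1 <-] d1] := inf_adherent e0 (distance_has_inf x H0).
have [_ [c2 Hc2 <-] d2] := inf_adherent e0 (distance_has_inf y H0).
have t1' : 0 <= 1 - t by rewrite subr_ge0.
apply: (@le_trans _ _ (t * `|x - c1| + (1 - t) * `|y - c2|)); last first.
  apply: (@le_trans _ _
    (t * (distance H x + e) + (1 - t) * (distance H y + e))).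
    by apply: lerD; rewrite ler_wpM2l// ltW.
  by rewrite !mulrDr addrACA -(mulrDl t) subrKC mul1r.
apply: (@le_trans _ _ `|t *: (x - c1) + (1 - t) *: (y - c2)|).
  apply: ge_inf.
    by case: (distance_has_inf (t *: (x : V) + (1 - t) *: (y : V)) H0).
  exists (t *: c1 + (1 - t) *: c2); first exact: Hc.
  by rewrite !scalerBr opprD addrACA.
by rewrite (le_trans (ler_normD _ _))// !normrZ !ger0_norm.
Qed.

Lemma distance_le0 (R : realType) (V : normedModType R) (H : set V) z :
  H z -> distance H z <= 0.
Proof.
move=> Hz; have H0 : H !=set0 by exists z.
rewrite /distance; apply: ge_inf; first by case: (distance_has_inf z H0).
by exists z => //; rewrite subrr normr0.
Qed.

(** Every ball around [z] meets [H]. Nonemptiness matters: the infimum of the empty set defaults to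
    0. *)
Lemma closed_distance_le0 (R : realType) (V : normedModType R) (H : set V) z :
  H !=set0 -> closed H -> distance H z <= 0 -> H z.
Proof.
move=> H0 Hcl Dz; apply: Hcl => B /nbhs_ballP[e /= e0 eB].
have [_ [c Hc <-] d] := inf_adherent e0 (distance_has_inf z H0).
exists c; split => //; apply: eB; rewrite -ball_normE /=.
by rewrite (lt_le_trans d)// gerDr.
Qed.

(** * Rank-one segments, and laminates inside the hull *)

Lemma mx_segmentP (R : realType) (X Y Z : 'M[R]_2) :
  mx_segment X Y Z <->
  exists t : R, [/\ 0 <= t, t <= 1 & Z = t *: X + (1 - t) *: Y].
Proof.
split=> [[t ->]|[t [t0 t1 ->]]]; first by exists t%:num.
by exists (Itv01 t0 t1).
Qed.

(** The last term is the defect of [\det] from being affine on a segment; it vanishes exactly when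
    needed, on rank-one segments. *)
Lemma det2_conv (R : comPzRingType) (t : R) (X Y : 'M[R]_2) :
  \det (t *: X + (1 - t) *: Y) =
  t * \det X + (1 - t) * \det Y - t * (1 - t) * \det (X - Y).
Proof. by rewrite !det2 !mxE; ring. Qed.

Lemma lamination_sub_hull (R : realType) (K : set 'M[R]_2) k :
  lamination k K `<=` polyconvex_hull K.
Proof.
elim: k => [|k IH] Z; first by move=> KZ f _; exact.
move=> [[X Y] /= [/IH KX /IH KY]]; rewrite rank_le1_det => /eqP XY.
move=> /mx_segmentP[t [t0 t1 ->]] f fpc fK.
have fX := KX f fpc fK; have fY := KY f fpc fK.
move: fpc => [g gc fg].
(* The segment between these two points stays on the graph of [\det], where [g] computes [f]. *)
have := gc (Itv01 t0 t1) (X, \det X) (Y, \det Y).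
rewrite !in_setT => /(_ isT isT).
have -> : conv (Itv01 t0 t1)
    ((X, \det X) : convex_lmodType ('M[R]_2 * R^o)%type) (Y, \det Y) =
    (t *: X + (1 - t) *: Y, t * \det X + (1 - t) * \det Y) by [].
have -> : conv (Itv01 t0 t1) (g (X, \det X) : R^o) (g (Y, \det Y)) =
    t * g (X, \det X) + (1 - t) * g (Y, \det Y) by [].
rewrite fg det2_conv XY mulr0 subr0 -!fg => /le_trans; apply.
by rewrite -oppr_ge0 opprD -!mulrN addr_ge0// mulr_ge0// ?subr_ge0// oppr_ge0.
Qed.

(** * The graph of the determinant and the polyconvex hull *)

Definition det_graph (R : realType) (K : set 'M[R]_2) : set ('M[R]_2 * R^o) :=
  (fun X => (X, \det X)) @` K.

Lemma det2_continuous (R : realType) :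
  continuous (fun X : 'M[R]_2 => \det X : R^o).
Proof.
have c i j : continuous (fun X : 'M[R]_2 => X i j) by exact: coord_continuous.
under eq_fun do rewrite det2.
by move=> X; exact: cvgB (cvgM (c 0 0 X) (c 1 1 X)) (cvgM (c 0 1 X) (c 1 0 X)).
Qed.

Lemma det_graph_compact (R : realType) (K : set 'M[R]_2) :
  compact K -> compact (det_graph K).
Proof.
move=> Kc; apply: continuous_compact => //; apply: continuous_subspaceT.
apply: (@continuous_pair _ 'M[R]_2 R^o); first by move=> x; exact: cvg_id.
exact: det2_continuous.
Qed.

Lemma hull_sub_convex_comb (R : realType) (K : set 'M[R]_2) n X :
  compact K -> (dim ('M[R]_2 * R^o)%type <= n)%N ->
  polyconvex_hull K X -> convex_comb n.+1 (det_graph K) (X, \det X).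
Proof.
move=> Kc nV KX; set H := convex_comb _ _.
have H0 : H !=set0.
  have [K0|/set0P[Y KY]] := eqVneq K set0; last first.
    by exists (Y, \det Y); apply: subset_convex_comb; exists Y.
  (* For empty [K] the constant 1 is an admissible test function, so the hull has no point [X]. *)
  have : (1 : R) <= 0.
    apply: (KX (fun=> 1)); last by rewrite K0.
    exists (fun=> 1) => // t x y _ _.
    have -> : conv t (1 : R^o) 1 = t%:num * 1 + (1 - t%:num) * 1 by [].
    by rewrite !mulr1 subrKC.
  by rewrite ler10.
have Hconv t x y : 0 <= t -> t <= 1 -> H x -> H y -> H (t *: x + (1 - t) *: y).
  (* This combination has [n.+1 + n.+1] points; as [n] is at least the dimension, Carathéodory
     reduces it to [n.+1]. *)
  move=> t0 t1 Hx Hy; have := convex_comb_conv t0 t1 Hx Hy.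
  apply: convex_comb_reduce => m nm; apply: convex_comb_finite_dim.
  exact: leq_ltn_trans nV nm.
have Hcl : closed H by apply/convex_comb_closed/det_graph_compact.
apply: (closed_distance_le0 H0 Hcl).
apply: (KX (fun Y => distance H (Y, \det Y))).
  exists (distance H) => //.
  exact: distance_convex.
move=> Y KY; apply: distance_le0.
by apply: subset_convex_comb; exists Y.
Qed.

(** * From isotropic barycentres to second-order laminates *)

Lemma lamination2_comb3 (R : realType) (K : set 'M[R]_2) (X : 'M[R]_2)
    (A : set 'M[R]_2) :
  A `<=` K -> (forall Y Z, A Y -> A Z -> \det (Y - Z) = 0) ->
  convex_comb 3 A X -> lamination 2 K X.
Proof.
move=> AK A0 [w [y [[w0 w1] yA ->]]].
move: w1; rewrite !big_ord_recl !big_ord0 !addr0.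
set i1 := lift ord0 _; set i2 := lift ord0 _.
move: (w0 ord0) (w0 i1) (w0 i2) (yA ord0) (yA i1) (yA i2).
move: (w ord0) (w i1) (w i2) (y ord0) (y i1) (y i2).
move=> a b c P Q S a0 b0 c0 AP AQ AS abc.
have aE : 1 - a = b + c by rewrite -abc addrC addKr.
(* The inner segment joins [Q] to [S], the outer one joins [P] to the result. If [b + c = 0] then
   [s] is 0 by convention, which is harmless since [b = c = 0]. *)
pose s := b / (b + c).
have bc0 : 0 <= b + c by exact: addr_ge0.
have s0 : 0 <= s by rewrite divr_ge0.
have s1 : s <= 1.
  rewrite /s; have [->|bc] := eqVneq (b + c) 0; first by rewrite invr0 mulr0.
  by rewrite ler_pdivrMr ?mul1r ?lerDl// lt_neqAle eq_sym bc.
have bE : (1 - a) * s = b.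
  rewrite aE /s; have [bc|bc] := eqVneq (b + c) 0; last by rewrite mulrC divfK.
  rewrite bc mul0r; apply/esym/eqP.
  by move/eqP: bc; rewrite paddr_eq0// => /andP[].
have lam1 Y Z W : A Y -> A Z -> mx_segment Y Z W -> lamination 1 K W.
  move=> AY AZ YZW; exists (Y, Z) => //=; split; [exact: AK|exact: AK|].
  by rewrite rank_le1_det A0.
exists (P, s *: Q + (1 - s) *: S) => /=.
  split.
  - apply: (lam1 P P) => //; apply/mx_segmentP; exists 0.
    by rewrite lexx ler01 scale0r add0r subr0 scale1r.
  - by apply: (lam1 Q S) => //; apply/mx_segmentP; exists s.
  - rewrite rank_le1_det.
    (* The difference is a combination of [P - Q] and [P - S], which are isotropic along with their
       own difference [S - Q]. *)
    have -> : P - (s *: Q + (1 - s) *: S) = s *: (P - Q) + (1 - s) *: (P - S).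
      by apply/matrixP => i j; rewrite !mxE; ring.
    rewrite det2_conv.
    have -> : P - Q - (P - S) = S - Q by rewrite opprB addrC addrA subrK.
    by rewrite !A0// !mulr0 addr0 subr0.
apply/mx_segmentP; exists a; split => //.
  by rewrite -subr_ge0 aE.
rewrite scalerDr !scalerA bE; congr (_ + (_ + _ *: _)).
by rewrite mulrBr mulr1 bE aE addrC addKr.
Qed.

(* If [X] is the barycentre, [\sum_i w i * det (y i - X) = 0], and
   [det (y i - X)] is the [w]-average of the [det (y i - y j)]. *)
Lemma convex_comb_det_isotropic (R : realType) n (w : 'I_n -> R)
    (y : 'I_n -> 'M[R]_2) :
    weights w -> (forall i j, 0 <= \det (y i - y j)) ->
    \sum_i w i * \det (y i) = \det (\sum_i w i *: y i) ->
  forall i j, 0 < w i -> 0 < w j -> \det (y i - y j) = 0.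
Proof.
move=> [w0 w1] y0 wdet.
pose X := \sum_i w i *: y i.
have XE a b : \sum_j w j * y j a b = X a b.
  by rewrite summxE; apply: eq_bigr => j _; rewrite !mxE.
(* [\det (Z - Y)] is affine in the pair [(Y, \det Y)], and [wdet] says that averaging these pairs
   over [y] gives [(X, \det X)]. *)
have lin Z : \sum_j w j * \det (Z - y j) = \det (Z - X).
  transitivity (\det Z * (\sum_j w j) - Z 0 0 * (\sum_j w j * y j 1 1)
    - Z 1 1 * (\sum_j w j * y j 0 0) + Z 0 1 * (\sum_j w j * y j 1 0)
    + Z 1 0 * (\sum_j w j * y j 0 1) + \sum_j w j * \det (y j)).
    rewrite !mulr_sumr -!sumrB -!big_split/=; apply: eq_bigr => j _.
    by rewrite !det2 !mxE; ring.
  by rewrite w1 !XE wdet -/X !det2 !mxE; ring.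
have Xge0 i : 0 <= \det (y i - X).
  by rewrite -lin sumr_ge0// => j _; rewrite mulr_ge0.
(* This is [lin] at [X], since [\det] is even on 2 x 2 matrices. *)
have X0 : \sum_i w i * \det (y i - X) = 0.
  transitivity (\sum_i w i * \det (X - y i)).
    by apply: eq_bigr => i _; rewrite !det2 !mxE; ring.
  by rewrite lin subrr det0.
move=> i j wi wj.
have /eqP yiX : \det (y i - X) == 0.
  have : w i * \det (y i - X) == 0.
    move/eqP: X0; rewrite psumr_eq0 => [/allP/(_ i (mem_index_enum i))//|k _].
    by rewrite mulr_ge0.
  by rewrite mulf_eq0 gt_eqF.
have : w j * \det (y i - y j) == 0.
  move/eqP: yiX; rewrite -lin psumr_eq0.
    by move=> /allP/(_ j (mem_index_enum j)).
  move=> k _.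
  by rewrite mulr_ge0.
by rewrite mulf_eq0 gt_eqF// => /eqP.
Qed.

Theorem proposition2p6 (R : realType) (K : set 'M[R]_2)
  (K_compact : compact K)
  (K_det : forall X Y : 'M[R]_2, K X -> K Y -> 0 <= \det (X - Y)) :
  polyconvex_hull K = lamination 2 K.
Proof.
apply/seteqP; split; last exact: lamination_sub_hull.
(* The offset 2 writes the number of points [N.+1] as 3 plus the dimension, ready for the final
   reduction to three points. *)
move=> X KX; set N := (dim ('M[R]_2 * R^o)%type + 2)%N.
have [w [z [ww zK XE]]] :=
  hull_sub_convex_comb K_compact (leq_addr 2 _ : (_ <= N)%N) KX.
have {zK}/choice[y yK] i : exists Y, K Y /\ z i = (Y, \det Y).
  by have [Y KY <-] := zK i; exists Y.
have XyE : X = \sum_i w i *: y i.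
  have /(congr1 fst) /= := XE; rewrite raddf_sum => ->.
  by apply: eq_bigr => i _; rewrite (yK i).2.
have detXE : \det X = \sum_i w i * \det (y i).
  have /(congr1 snd) /= := XE; rewrite raddf_sum => ->.
  by apply: eq_bigr => i _; rewrite (yK i).2.
have det0 := convex_comb_det_isotropic ww
  (fun i j => K_det _ _ (yK i).1 (yK j).1).
rewrite -detXE XyE in det0; have {}det0 := det0 erefl.
(* Isotropy is known only between points of positive weight, so the others are left out. *)
pose A := [set y i | i in [set i | 0 < w i]].
apply: (@lamination2_comb3 _ _ _ A); first by move=> _ [i _ <-]; case: (yK i).
  by move=> _ _ [i wi <-] [j wj <-]; exact: det0.
have [i0 wi0] : exists i, 0 < w i.
  apply/existsP; apply: contraT => /existsPn wn.
  have := ww.2; rewrite big1 => [/eqP|i _]; first by rewrite eq_sym oner_eq0.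
  by apply/eqP; rewrite eq_le ww.1 andbT leNgt wn.
(* The number of terms is kept: where the weight is 0, the point is replaced by [y i0], which lies
   in [A]. *)
have : convex_comb N.+1 A X.
  exists w, (fun i => if 0 < w i then y i else y i0); split => //.
    by move=> i; case: ifP => wi; [exists i|exists i0].
  rewrite XyE; apply: eq_bigr => i _; case: ifPn => //.
  rewrite -leNgt => wi; have -> : w i = 0 by apply/eqP; rewrite eq_le wi ww.1.
  by rewrite !scale0r.
rewrite /N addnC -addSn; apply: convex_comb_reduce => n n3.
apply: convex_comb_isotropic => //.
by move=> _ _ [i wi <-] [j wj <-]; exact: det0.
Qed.
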